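(* For every integer $\tau\geq3$ there is a constant $\theta=\theta(\tau)>0$ such that the following holds. Let $D=(V,A)$ be a bipartite digraph in which every sink has degree $\tau$ and every dicut has size at least $\tau$. Then the number of minimal dijoins of $D$ that intersect every minimum dicut exactly once is at least $e^{\theta|A|}$.
   Context: A bipartite digraph is a digraph $D=(V,A)$ in which every vertex is a source (no entering arcs) or a sink (no leaving arcs). A dicut is an arc set $\delta^+(U)$ (the arcs leaving $U$) where $\emptyset\neq U\subsetneq V$ and $\delta^-(U)=\emptyset$ (no arc enters $U$). A dijoin is a subset of $A$ intersecting every dicut; it is minimal if no proper subset is a dijoin. A minimum dicut is a dicut of minimum size. *)

(* Defs.v *)
From mathcomp Require Import all_boot.

Set Implicit Arguments.
Unset Strict Implicit.
Unset Printing Implicit Defensive.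

(* Finite digraphs; parallel arcs are allowed. *)
Record digraph := Digraph {
  vertices : finType;
  arcs : finType;
  arc_tail : arcs -> vertices;
  arc_head : arcs -> vertices
}.

Section Digraph.
Variable D : digraph.
Implicit Types (v : vertices D) (U : {set vertices D}) (C J : {set arcs D}).

Definition arcs_out U : {set arcs D} :=
  [set a | (arc_tail a \in U) && (arc_head a \notin U)].
Definition arcs_in U : {set arcs D} :=
  [set a | (arc_tail a \notin U) && (arc_head a \in U)].

(* A loop at [v] makes [v] neither a source nor a sink. *)
Definition is_source v : bool := [forall a : arcs D, arc_head a != v].
Definition is_sink v : bool := [forall a : arcs D, arc_tail a != v].

Definition bipartite : Prop := forall v, is_source v || is_sink v.

Definition degree v : nat :=
  #|[set a : arcs D | arc_tail a == v]| + #|[set a : arcs D | arc_head a == v]|.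

Definition is_dicut C : bool :=
  [exists U : {set vertices D},
     [&& U != set0, U \proper [set: vertices D], arcs_in U == set0
       & C == arcs_out U]].

Definition is_min_dicut C : bool :=
  is_dicut C && [forall C' : {set arcs D}, is_dicut C' ==> (#|C| <= #|C'|)].

Definition is_dijoin J : bool :=
  [forall C : {set arcs D}, is_dicut C ==> (J :&: C != set0)].

Definition is_minimal_dijoin J : bool :=
  is_dijoin J && [forall J' : {set arcs D}, (J' \proper J) ==> ~~ is_dijoin J'].

Definition meets_min_dicuts_once J : bool :=
  [forall C : {set arcs D}, is_min_dicut C ==> (#|J :&: C| == 1)].

Definition tight_minimal_dijoins : {set {set arcs D}} :=
  [set J | is_minimal_dijoin J && meets_min_dicuts_once J].

End Digraph.

(* Main.v *)
Require Import Defs.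
From mathcomp Require Import all_boot all_order all_algebra.
From mathcomp Require Import reals sequences exp.
From mathcomp Require Import ring lra.

Set Implicit Arguments.
Unset Strict Implicit.
Unset Printing Implicit Defensive.
Import Order.TTheory GRing.Theory Num.Theory.
Local Open Scope ring_scope.

(** Write [m] for the number of arcs.  If [z] is a vector with entries in
    [[-1, 1]] whose balance (outflow minus inflow) vanishes at every vertex, then
    [x = (1 + z) / tau] gives every dicut total weight at least 1, and every
    minimum dicut weight exactly 1.  The tight cuts of [x] form a crossing family,
    so the classes of vertices that they do not separate have integral balance;
    a cycle of fractional arcs through these classes shows that [x] is a convex
    combination of (minimal) dijoins meeting every minimum dicut once.

    There are many such [z]: as degrees are at least [tau >= 3], we have
    [#|V| <= 2m/3], hence at least [2 ^ (m/3)] arc sets with all degrees even, and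
    each is the support of some [z] with entries [0, 1, -1].  By Maurey's empirical
    method, [x] is determined, up to an error of at most [m / 64] arcs in the
    support of [z], by [q = 256 tau^2] of the dijoins in question.  If there are
    [N] of these, then [N ^ q] times the number of arc sets of size at most
    [m / 64] is at least [2 ^ (m/3)], so [N] is exponential in [m]. *)

(** * Linear algebra and integral points of polyhedra *)

Lemma sum_eq_mem (T : finType) (B : {pred T}) (u : T) :
  (\sum_(v in B) (u == v) = (u \in B))%N.
Proof.
rewrite big_mkcond /= (bigD1 u) //= eqxx big1 ?addn0; first by case: (u \in B).
by move=> v /negbTE; rewrite eq_sym => ->; case: ifP.
Qed.

Lemma sumr_eq_mem (R : pzSemiRingType) (T : finType) (B : {pred T}) (u : T) :
  \sum_(v in B) (u == v)%:R = (u \in B)%:R :> R.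
Proof. by rewrite -natr_sum sum_eq_mem. Qed.

(* The incidence matrix of a multigraph with no vertex of degree 1 has at most
   as many nonzero columns as rows, and its columns sum to 0, so its rows are
   dependent. *)
Lemma exists_circulation (R : fieldType) (A T : finType) (s t : A -> T)
    (F : {set A}) :
  F != set0 ->
  (forall u, (\sum_(a in F) ((s a == u) + (t a == u)))%N != 1%N) ->
  exists d : A -> R, [/\ exists a, d a != 0, forall a, a \notin F -> d a = 0 &
    forall u, \sum_a d a * ((s a == u)%:R - (t a == u)%:R) = 0].
Proof.
move=> F0 degF.
pose deg u := (\sum_(a in F) ((s a == u) + (t a == u)))%N.
pose K := [set u | deg u != 0%N].
have KF : (#|K| <= #|F|)%N.
  have : (\sum_(u in K) 2 <= \sum_(u in K) deg u)%N.
    by apply: leq_sum => u; rewrite inE; move: (degF u); rewrite -/(deg u);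
      case: (deg u) => [|[]].
  rewrite sum_nat_const /deg exchange_big /= => /leq_trans h.
  rewrite -(leq_pmul2r (ltn0Sn 1)) -(sum_nat_const (mem F) 2); apply: h.
  apply: leq_sum => a aF; rewrite big_split /=.
  by rewrite !sum_eq_mem (leq_add (leq_b1 _) (leq_b1 _)).
have sK a : a \in F -> (s a \in K) && (t a \in K).
  by move=> aF; rewrite !inE -!lt0n; apply/andP; split;
    rewrite /deg (bigD1 a) //= eqxx ?addn1.
pose B : 'M[R]_(#|F|, #|K|) := \matrix_(i, j)
  ((s (enum_val i) == enum_val j)%:R - (t (enum_val i) == enum_val j)%:R).
have B1 : B *m (const_mx 1 : 'cV_#|K|) = 0.
  apply/matrixP => i j; rewrite !mxE.
  under eq_bigr do rewrite !mxE mulr1.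
  rewrite -(big_enum_val (fun u =>
    (s (enum_val i) == u)%:R - (t (enum_val i) == u)%:R)).
  rewrite sumrB !sumr_eq_mem.
  by have /andP[-> ->] := sK _ (enum_valP i); rewrite subrr.
have [a0 a0F] := set0Pn _ F0.
have rB : (\rank B < #|F|)%N.
  apply: leq_trans KF; have := mulmx0_rank_max B1.
  suff -> : \rank (const_mx 1 : 'cV[R]_#|K|) = 1%N by rewrite addn1.
  have /andP[saK _] := sK _ a0F.
  apply/eqP; rewrite eqn_leq rank_leq_col lt0n mxrank_eq0.
  apply/eqP => /matrixP /(_ (enum_rank_in saK (s a0)) 0); rewrite !mxE.
  exact/eqP/oner_neq0.
have /rowV0Pn[v vB v0] : kermx B != 0.
  by rewrite -mxrank_eq0 mxrank_ker subn_eq0 -ltnNge.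
move/sub_kermxP in vB.
pose d a := \sum_i v 0 i * (enum_val i == a)%:R.
have dE i : d (enum_val i) = v 0 i.
  rewrite /d (bigD1 i) //= eqxx mulr1 big1 ?addr0 // => j ji.
  by rewrite (inj_eq enum_val_inj) (negbTE ji) mulr0.
exists d; split.
- have [i vi] := rV0Pn _ v0.
  by exists (enum_val i); rewrite dE.
- move=> a aF; rewrite /d big1 // => i _; case: eqP => [ia|]; last by rewrite mulr0.
  by rewrite -ia enum_valP in aF.
- move=> u.
  have dF (f : A -> R) : \sum_a d a * f a = \sum_i v 0 i * f (enum_val i).
    under eq_bigr do rewrite mulr_suml.
    rewrite exchange_big /=; apply: eq_bigr => i _.
    rewrite (bigD1 (enum_val i)) //= eqxx mulr1 big1 ?addr0 // => a.
    by rewrite eq_sym => /negbTE ->; rewrite mulr0 mul0r.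
  rewrite dF; have [uK|uK] := boolP (u \in K).
    have /matrixP/(_ 0 (enum_rank_in uK u)) := vB; rewrite !mxE => {2}<-.
    by apply: eq_bigr => i _; rewrite !mxE enum_rankK_in.
  apply: big1 => i _; have /andP[sk tk] := sK _ (enum_valP i).
  have /negbTE -> : s (enum_val i) != u by apply: contraNneq uK => <-.
  have /negbTE -> : t (enum_val i) != u by apply: contraNneq uK => <-.
  by rewrite subrr mulr0.
Qed.

(** The ratio test of the simplex method: the step length is the least ratio [s i / - l i] over the
    decreasing coordinates. Coordinates already at 0 do not move, so the minimiser is a coordinate
    that becomes 0 only now. *)
Lemma exists_first_hit (R : realFieldType) (I : finType) (s l : I -> R) :
  (forall i, 0 <= s i) -> (forall i, s i = 0 -> l i = 0) ->
  (exists i, l i < 0) ->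
  exists e, [/\ 0 < e, forall i, 0 <= s i + e * l i &
    exists2 i, s i != 0 & s i + e * l i = 0].
Proof.
move=> s0 sl [i0 li0].
case: (@arg_minP _ _ _ i0 (fun i => l i < 0) (fun i => s i / - l i)) => // j lj jmin.
have sj : s j != 0 by apply: contraTneq lj => /sl ->; rewrite ltxx.
have sj0 : 0 < s j by rewrite lt0r sj s0.
exists (s j / - l j); split; first by rewrite divr_gt0 // oppr_gt0.
  move=> i; have [li|li] := ltP (l i) 0.
    have := jmin _ li; rewrite ler_pdivlMr ?oppr_gt0 // mulrN; lra.
  by rewrite addr_ge0 // mulr_ge0 // divr_ge0 // oppr_ge0 ltW.
by exists j => //; field; rewrite lt_eqF.
Qed.

(* A non-integral point lies in the relative interior of a segment of its
   minimal face; moving along the segment in the direction that does not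
   decrease the objective makes a further constraint tight. *)
Lemma exists_integral_point (R : archiRealFieldType) (A I : finType)
    (c : I -> A -> R) (b : I -> R) (w x0 : A -> R) :
  let slack x i := \sum_a c i a * x a - b i in
  (forall x, (forall i, 0 <= slack x i) ->
     (forall i, slack x0 i = 0 -> slack x i = 0) ->
     (exists a, x a \isn't a Num.int) ->
     exists d : A -> R,
       [/\ forall i, slack x i = 0 -> \sum_a c i a * d a = 0,
           exists i, \sum_a c i a * d a < 0 &
           exists i, 0 < \sum_a c i a * d a]) ->
  (forall i, 0 <= slack x0 i) ->
  exists x, [/\ forall i, 0 <= slack x i,
    forall i, slack x0 i = 0 -> slack x i = 0,
    forall a, x a \is a Num.int & \sum_a w a * x0 a <= \sum_a w a * x a].
Proof.
move=> slack dir feas0.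
(* Induction on the number of constraints that are not tight. *)
suff improve n x : (#|[set i | slack x i != 0%R]| < n)%N ->
    (forall i, 0 <= slack x i) -> (forall i, slack x0 i = 0 -> slack x i = 0) ->
    \sum_a w a * x0 a <= \sum_a w a * x a ->
    exists y, [/\ forall i, 0 <= slack y i,
      forall i, slack x0 i = 0 -> slack y i = 0,
      forall a, y a \is a Num.int & \sum_a w a * x0 a <= \sum_a w a * y a].
  exact: improve (leqnn _) _ _ _.
elim: n x => // n IHn x lt_n feas tight wx.
have [xint|] := boolP [forall a, x a \is a Num.int].
  by exists x; split=> // a; apply: (forallP xint).
rewrite negb_forall => /existsP xnint.
have [d0 [d0tight d0neg d0pos]] := dir x feas tight xnint.
have sumN i : \sum_a c i a * - d0 a = - \sum_a c i a * d0 a.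
  by rewrite -sumrN; apply: eq_bigr => a _; rewrite mulrN.
(* Reverse [d0] if it decreases the objective. Since [d0] changes slacks in both directions, some
   slack decreases either way, and the move is stopped by a constraint. *)
have [d [dtight dneg wd]] : exists d : A -> R,
    [/\ forall i, slack x i = 0 -> \sum_a c i a * d a = 0,
        exists i, \sum_a c i a * d a < 0 & 0 <= \sum_a w a * d a].
  have [wd|/ltW wd] := leP 0 (\sum_a w a * d0 a); first by exists d0.
  exists (fun a => - d0 a); split.
  - by move=> i /d0tight; rewrite sumN => ->; rewrite oppr0.
  - by have [i ipos] := d0pos; exists i; rewrite sumN oppr_lt0.
  - by under eq_bigr do rewrite mulrN; rewrite sumrN oppr_ge0.
have [e [e0 efeas [j sj ej]]] := exists_first_hit feas dtight dneg.
pose y a := x a + e * d a.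
have sumD (f : A -> R) :
    \sum_a f a * y a = \sum_a f a * x a + e * \sum_a f a * d a.
  by rewrite mulr_sumr -big_split /=; apply: eq_bigr => a _; rewrite /y; ring.
have slackE i : slack y i = slack x i + e * \sum_a c i a * d a.
  by rewrite /slack sumD addrAC.
have ytight i : slack x i = 0 -> slack y i = 0.
  by move=> si; rewrite slackE si dtight // mulr0 addr0.
apply: (IHn y).
- move: lt_n; rewrite ltnS; apply: leq_trans; apply: proper_card; apply/properP; split.
    by apply/subsetP => i; rewrite !inE; apply: contra_neq => /ytight.
  by exists j; rewrite !inE ?sj // slackE ej eqxx.
- by move=> i; rewrite slackE.
- by move=> i /tight /ytight.
- by rewrite sumD; apply: le_trans wx _; rewrite lerDl mulr_ge0 // ltW.
Qed.

(** * Balances and cuts *)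

Section Balance.
Variables (R : archiRealFieldType) (D : digraph).
Local Notation V := (vertices D).
Local Notation A := (arcs D).
Implicit Types (x d : A -> R) (U : {set V}).

Definition balance x (v : V) : R :=
  \sum_a x a * ((arc_tail a == v)%:R - (arc_head a == v)%:R).

(** On a shore that no arc enters this is the weight of the dicut. Being a sum over vertices it is
    modular, so uncrossing works with equalities. *)
Definition net x U : R := \sum_(v in U) balance x v.

Lemma netE x U :
  net x U = \sum_a x a * ((arc_tail a \in U)%:R - (arc_head a \in U)%:R).
Proof.
rewrite /net exchange_big /=; apply: eq_bigr => a _.
by rewrite -mulr_sumr sumrB !sumr_eq_mem.
Qed.

Lemma netT x : net x setT = 0.
Proof. by rewrite netE big1 // => a _; rewrite !inE subrr mulr0. Qed.

Lemma net0 x : net x set0 = 0.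
Proof. by rewrite /net big_set0. Qed.

Lemma net_disjointU x U U' :
  [disjoint U & U'] -> net x (U :|: U') = net x U + net x U'.
Proof. move=> UU'; rewrite /net -bigU //=; apply: eq_bigl => v; by rewrite !inE. Qed.

Lemma netC x U : net x (~: U) = - net x U.
Proof.
apply/eqP; rewrite -addr_eq0 -net_disjointU; last by rewrite -setI_eq0 setIC setICr.
by rewrite setUC setUCr netT.
Qed.

Lemma netUI x U U' : net x (U :|: U') + net x (U :&: U') = net x U + net x U'.
Proof.
rewrite !netE -!big_split /=; apply: eq_bigr => a _; rewrite !inE.
by do 4!case: (_ \in _) => /=; ring.
Qed.

Lemma net_arcs_out x U : arcs_in U = set0 -> net x U = \sum_(a in arcs_out U) x a.
Proof.
move=> /setP Uin; rewrite netE [RHS]big_mkcond /=; apply: eq_bigr => a _.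
have := Uin a; rewrite !inE.
by case: (_ \in U); case: (_ \in U) => //= _; rewrite ?subrr ?subr0 ?mulr0 ?mulr1.
Qed.

(* The arcs with a non-integral value cannot have exactly one end in a class on
   which the balance is integral. *)
Lemma exists_fractional_circulation (T : finType) (k : V -> T) x :
  (forall t, net x [set v | k v == t] \is a Num.int) ->
  (exists a, x a \isn't a Num.int) ->
  exists d, [/\ exists a, d a != 0, forall a, x a \is a Num.int -> d a = 0 &
    forall t, net d [set v | k v == t] = 0].
Proof.
move=> kint [a0 xa0]; pose F := [set a | x a \isn't a Num.int].
have Fint a : a \notin F -> x a \is a Num.int by rewrite inE negbK.
(* Contract each class of [k] to a point. An arc inside a class becomes a loop, which counts twice
   in the degree and adds nothing to the net. *)
have [||d [d0 dF dnet]] :=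
  @exists_circulation R A T (k \o @arc_tail D) (k \o @arc_head D) F.
- by apply/set0Pn; exists a0; rewrite inE.
- move=> t; apply/negP => /eqP deg1; have := kint t.
  rewrite netE (bigID (mem F)) /= rpredDr; last first.
    apply: rpred_sum => a /Fint xa.
    by rewrite rpredM // rpredB // natr_int.
  have [a aF [ea eF]] : exists2 a, a \in F &
      ((k (arc_tail a) == t) + (k (arc_head a) == t) = 1)%N /\
      forall b, b \in F -> b != a ->
        ((k (arc_tail b) == t) + (k (arc_head b) == t) = 0)%N.
    have [a /andP[aF ea]|h] := pickP (fun a => (a \in F) &&
        (((k (arc_tail a) == t) + (k (arc_head a) == t))%N != 0%N)); last first.
      by move: deg1; rewrite big1 // => a aF; have := h a; rewrite aF => /negbFE/eqP.
    exists a => //; move: deg1; rewrite (bigD1 a) //=.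
    move: ea; rewrite -lt0n; case: (_ + _)%N => // [[|//]] _ [] /eqP.
    rewrite sum_nat_eq0 => /forallP h; split=> // b bF ba.
    by move: (h b); rewrite bF ba => /eqP.
  rewrite (bigD1 a) //= big1 ?addr0.
    move: ea aF; rewrite !inE; case: (_ == t); case: (_ == t) => //= _ /negbTE.
      by rewrite subr0 mulr1 => ->.
    by rewrite sub0r mulrN1 rpredN => ->.
  move=> b /andP[bF ba]; have := eF b bF ba; rewrite !inE.
  by case: (_ == t); case: (_ == t) => //= _; rewrite subrr mulr0.
exists d; split=> //.
  by move=> a xa; apply: dF; rewrite inE negbK.
by move=> t; rewrite netE -[RHS](dnet t); apply: eq_bigr => a _; rewrite !inE.
Qed.

End Balance.

Lemma sumr_delta (R : pzSemiRingType) (A : finType) (f : A -> R) (a : A) :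
  \sum_b (b == a)%:R * f b = f a.
Proof.
rewrite (bigD1 a) //= eqxx mul1r big1 ?addr0 // => b /negbTE ->.
by rewrite mul0r.
Qed.

Lemma sumr_eq0_signs (R : realDomainType) (A : finType) (S : {pred A})
    (f : A -> R) (a : A) :
  \sum_(b in S) f b = 0 -> a \in S -> f a != 0 ->
  (exists b, f b < 0) /\ (exists b, 0 < f b).
Proof.
move=> fS aS fa; split.
- have [b fb|h] := pickP (fun b => f b < 0); first by exists b.
  case/eqP: fa; apply: (psumr_eq0P _ fS) => // b _.
  by rewrite leNgt h.
- have [b fb|h] := pickP (fun b => 0 < f b); first by exists b.
  case/eqP: fa; apply/eqP; rewrite -oppr_eq0; apply/eqP.
  apply: (@psumr_eq0P _ _ _ (fun b => - f b)) aS => [b _|].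
    by rewrite oppr_ge0 leNgt h.
  by rewrite sumrN fS oppr0.
Qed.

(** * Even arc sets as supports of signed circulations *)

Section EvenSets.
Variables (R : archiRealFieldType) (D : digraph).
Local Notation V := (vertices D).
Local Notation A := (arcs D).

Definition degree_in (E : {set A}) (v : V) : nat :=
  \sum_(a in E) ((arc_tail a == v) + (arc_head a == v)).

(* Round half the indicator of [E], whose balance is integral at every vertex,
   to a 0-1 vector with the same balance. *)
Lemma exists_signed_circulation (E : {set A}) :
  (forall v, ~~ odd (degree_in E v)) ->
  exists z : A -> R, [/\ forall a, a \notin E -> z a = 0,
    forall a, a \in E -> z a = 1 \/ z a = -1 & forall v, balance z v = 0].
Proof.
move=> Eeven; pose x0 a : R := (a \in E)%:R / 2.
(* The balance is half the degree in [E] minus the indegree in [E]. *)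
have bal0 v : balance x0 v \is a Num.int.
  have -> : balance x0 v = (degree_in E v)./2%:R - \sum_(a in E) (arc_head a == v)%:R.
    have -> : (degree_in E v)./2%:R = (degree_in E v)%:R / 2 :> R.
      rewrite -{2}[degree_in E v]odd_double_half (negbTE (Eeven v)) add0n.
      by rewrite -muln2 natrM; field.
    rewrite /degree_in natr_sum mulr_suml -sumrB [RHS]big_mkcond /=.
    apply: eq_bigr => a _; rewrite /x0; case: ifP => _ /=; last by field.
    by rewrite natrD; field.
  rewrite rpredB ?natr_int // rpred_sum // => a _; exact: natr_int.
(* The constraints are [x a >= 0], [x a <= 1] and [balance x v >= balance x0 v]. Those of the last
   kind, and [x a >= 0] for [a] outside [E], are tight at [x0] and therefore remain tight. *)
pose I := (A + A + V)%type.
pose c (i : I) (a : A) : R := match i with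
  | inl (inl b) => (a == b)%:R
  | inl (inr b) => - (a == b)%:R
  | inr v => (arc_tail a == v)%:R - (arc_head a == v)%:R end.
pose b (i : I) : R := match i with
  | inl (inl _) => 0 | inl (inr _) => -1 | inr v => balance x0 v end.
have cA f a : \sum_b c (inl (inl a)) b * f b = f a by rewrite sumr_delta.
have cB f a : \sum_b c (inl (inr a)) b * f b = - f a.
  by rewrite -[in RHS](sumr_delta f a) -sumrN; apply: eq_bigr => a' _; rewrite mulNr.
have cV f v : \sum_b c (inr v) b * f b = balance f v.
  by apply: eq_bigr => a' _; rewrite mulrC.
have [||x [xfeas xtight xint _]] := @exists_integral_point R A I c b (fun=> 0) x0.
- move=> x xfeas xtight xnint.
  have xbal v : balance x v = balance x0 v.
    by apply/eqP; rewrite -subr_eq0 -{1}cV (xtight (inr v)) // cV subrr.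
  have one f v : net f [set u | u == v] = balance f v.
    by rewrite /net (big_pred1 v) // => u; rewrite inE.
  have [v|d [[a da] dint dbal]] := @exists_fractional_circulation R D V id x _ xnint.
    by rewrite one xbal.
  exists d; split.
  + case=> [[a'|a']|v].
    * by rewrite !cA subr0 => xa; rewrite dint // xa int_num0.
    * rewrite !cB opprK addrC => /eqP; rewrite subr_eq0 => /eqP xa.
      by rewrite dint ?oppr0 // -xa int_num1.
    * by move=> _; rewrite cV -one; apply: dbal.
  + case: (ltP (d a) 0) => [da0|]; first by exists (inl (inl a)); rewrite cA.
    rewrite le0r (negbTE da) /= => da0; exists (inl (inr a)).
    by rewrite cB oppr_lt0.
  + case: (ltP (d a) 0) => [da0|].
      by exists (inl (inr a)); rewrite cB oppr_gt0.
    rewrite le0r (negbTE da) /= => da0; exists (inl (inl a)).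
    by rewrite cA.
- case=> [[a|a]|v]; rewrite ?cA ?cB ?cV /b /x0 ?subrr //; case: (a \in E) => /=; lra.
exists (fun a => 2 * x a - (a \in E)%:R); split.
- move=> a aE; rewrite (negbTE aE) subr0.
  have := xtight (inl (inl a)); rewrite !cA /= !subr0 => ->; first by rewrite mulr0.
  by rewrite /x0 (negbTE aE) mul0r.
- move=> a aE; rewrite aE.
  have := xfeas (inl (inl a)); have := xfeas (inl (inr a)).
  rewrite cA cB /= subr0 opprK addrC subr_ge0.
  have /intrP[m ->] := xint a; rewrite ler0z lerz1 => m1 m0.
  have [->|->] : m = 0 \/ m = 1 by case: m m0 m1 => // [[|[]]] //; [left|right].
    by right; ring.
  by left; ring.
- move=> v; have := xtight (inr v); rewrite !cV subrr => /(_ erefl)/eqP.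
  rewrite subr_eq0 => /eqP xbal.
  have -> : balance (fun a => 2 * x a - (a \in E)%:R) v =
      2 * (balance x v - balance x0 v).
    by rewrite -sumrB mulr_sumr; apply: eq_bigr => a _; rewrite /x0; field.
  by rewrite xbal subrr mulr0.
Qed.

End EvenSets.

(** * Uncrossing tight dicuts and rounding to a dijoin *)

Section Rounding.
Variables (R : archiRealFieldType) (D : digraph).
Local Notation V := (vertices D).
Local Notation A := (arcs D).
Implicit Types (x d : A -> R) (U W : {set V}).

Definition dicut_shore U : bool :=
  [&& U != set0, U \proper [set: V] & arcs_in U == set0].

Lemma dicut_shoreUI U U' : dicut_shore U -> dicut_shore U' ->
  U :&: U' != set0 -> ~: (U :|: U') != set0 ->
  dicut_shore (U :|: U') /\ dicut_shore (U :&: U').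
Proof.
move=> /and3P[_ UT /eqP/setP Uin] /and3P[_ _ /eqP/setP U'in] I0 CU0.
have [v] := set0Pn _ I0; rewrite inE => /andP[vU vU'].
have [u] := set0Pn _ CU0; rewrite !inE negb_or => /andP[uU uU'].
split; apply/and3P; split=> //.
- by apply/set0Pn; exists v; rewrite inE vU.
- by rewrite properT; apply: contraNneq uU => /setP/(_ u);
    rewrite !inE (negbTE uU') orbF => ->.
- apply/eqP/setP => a; have := Uin a; have := U'in a; rewrite !inE negb_or.
  by do 4!case: (_ \in _).
- by rewrite properT; apply: contraNneq uU => /setP/(_ u); rewrite !inE => /andP[].
- apply/eqP/setP => a; have := Uin a; have := U'in a; rewrite !inE.
  by do 4!case: (_ \in _).
Qed.

Section TightCuts.
Variable x : A -> R.
Hypothesis cover : forall U, dicut_shore U -> 1 <= net x U.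

Definition tight_shores : {set {set V}} :=
  [set U | dicut_shore U && (net x U == 1)].

Lemma tight_shoresUI U U' : U \in tight_shores -> U' \in tight_shores ->
  U :&: U' != set0 -> ~: (U :|: U') != set0 ->
  U :|: U' \in tight_shores /\ U :&: U' \in tight_shores.
Proof.
rewrite !inE => /andP[sU /eqP xU] /andP[sU' /eqP xU'] I0 CU0.
have [sUU sUI] := dicut_shoreUI sU sU' I0 CU0.
have := netUI x U U'; rewrite xU xU' sUU sUI /=.
have := cover sUU; have := cover sUI => h1 h2 h3.
by split; apply/eqP; lra.
Qed.

(** With complements included, any tight cut separating [v] from [s] has a side that contains [v]
    and avoids [s]. *)
Definition tight_sides : {set {set V}} :=
  [set U | (U \in tight_shores) || (~: U \in tight_shores)].

Lemma tight_sides_neq0 U : U \in tight_sides -> U != set0.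
Proof.
rewrite !inE => /orP[/andP[/and3P[]]//|/andP[/and3P[_ + _] _]].
by rewrite properT; apply: contraNneq => ->; rewrite setC0.
Qed.

Lemma net_tight_sides_int U : U \in tight_sides -> net x U \is a Num.int.
Proof.
rewrite !inE => /orP[/andP[_ /eqP->]|/andP[_]]; first exact: int_num1.
by rewrite netC -(rpredN _ (net x U)) => /eqP->; exact: int_num1.
Qed.

(** Uncross the shores among [P], [Q] and their complements. If [P] and [Q] are oriented alike, this
    yields [P :|: Q] or its complement; otherwise it yields [P :\: Q] or its complement. *)
Lemma tight_sides_crossing P Q : P \in tight_sides -> Q \in tight_sides ->
  P :&: Q != set0 -> P :\: Q != set0 -> Q :\: P != set0 -> ~: (P :|: Q) != set0 ->
  (P :|: Q \in tight_sides) \/ (P :\: Q \in tight_sides).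
Proof.
move=> PG QG PQ dPQ dQP cPQ; move: PG QG.
rewrite [P \in _]inE [Q \in _]inE => /orP[] hP /orP[] hQ.
- by left; rewrite inE; have [] := tight_shoresUI hP hQ PQ cPQ => ->.
- right; rewrite inE setDE; have [||_ ->] // := tight_shoresUI hP hQ.
    by rewrite -setDE.
  by rewrite setCU setCK setIC -setDE.
- right; rewrite inE setDE setCI setCK; have [||-> _] := tight_shoresUI hP hQ.
  + by rewrite setIC -setDE.
  + by rewrite setCU setCK -setDE.
  + by rewrite orbT.
- left; rewrite inE setCU; have [||_ ->] := tight_shoresUI hP hQ.
  + by rewrite -setCU.
  + by rewrite -setCI setCK.
  + by rewrite orbT.
Qed.

(* A maximal member Q of the family splits off: by [tight_sides_crossing] any
   other member P is contained in Q, or P :\: Q is again a member. *)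
Lemma net_bigcup_tight_sides_int (s : V) W : s \notin W ->
  net x (\bigcup_(Q in tight_sides | Q \subset W) Q) \is a Num.int.
Proof.
have [n] := ubnP #|W|; elim: n W => // n IHn W; rewrite ltnS => Wn sW.
have [Q0 Q0W|none] := pickP (fun Q => (Q \in tight_sides) && (Q \subset W)); last first.
  by rewrite big_pred0 // net0 int_num0.
have [Q /maxsetP[/andP[QG QW] Qmax] _] :=
  @maxset_exists _ (fun Q => (Q \in tight_sides) && (Q \subset W)) Q0 Q0W.
have -> : \bigcup_(P in tight_sides | P \subset W) P =
    Q :|: \bigcup_(P in tight_sides | P \subset W :\: Q) P.
  apply/setP => v; rewrite inE; apply/bigcupP/orP => [[P /andP[PG PW] vP]|].
    have [|vQ] := boolP (v \in Q); [by left|right].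
    have vPQ : v \in P :\: Q by rewrite inE vQ.
    have [PQ0|PQ0] := eqVneq (P :&: Q) set0.
      apply/bigcupP; exists P => //; rewrite PG subsetD PW.
      by rewrite -setI_eq0 PQ0 eqxx.
    have QP : Q :\: P != set0.
      rewrite setD_eq0; apply/negP => QP.
      by move: vQ; rewrite -(Qmax P _ QP) ?vP // PG.
    have [|| PUQ | PDQ] := tight_sides_crossing PG QG PQ0 _ QP.
    + by apply/set0Pn; exists v.
    + apply/set0Pn; exists s; rewrite !inE negb_or.
      by rewrite !(contra (subsetP _ _) sW).
    + have PQW : (P :|: Q \in tight_sides) && (P :|: Q \subset W).
        by rewrite PUQ subUset PW.
      by move: vQ; rewrite -(Qmax _ PQW (subsetUr _ _)) inE vP.
    + by apply/bigcupP; exists (P :\: Q) => //; rewrite PDQ setSD.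
  case=> [vQ|/bigcupP[P /andP[PG]]]; first by exists Q; rewrite ?QG.
  by rewrite subsetD => /andP[PW _] vP; exists P; rewrite ?PG.
rewrite net_disjointU; last first.
  rewrite -setI_eq0 big_distrr /= big1 // => P /andP[_].
  by rewrite subsetD setIC -setI_eq0 => /andP[_ /eqP].
apply: rpredD; first exact: net_tight_sides_int.
apply: IHn; last by rewrite inE negb_and sW orbT.
apply: leq_trans Wn; apply: proper_card; rewrite properE subsetDl.
have [v vQ] := set0Pn _ (tight_sides_neq0 QG).
by apply/subsetPn; exists v; rewrite ?(subsetP QW) // inE vQ.
Qed.

(** A class consists of the vertices lying in the same tight shores. The complement of the class of
    [s] is the union of all tight sides avoiding [s], whose net is integral; the net of a complement
    only changes sign. *)
Lemma net_tight_class_int (t : {set {set V}}) :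
  net x [set v | [set U in tight_shores | v \in U] == t] \is a Num.int.
Proof.
set K := [set v | _]; have [->|/set0Pn[s]] := eqVneq K set0.
  by rewrite net0 int_num0.
rewrite inE => /eqP st.
have := @net_bigcup_tight_sides_int s (~: [set s]).
rewrite !inE negbK => /(_ (eqxx _)).
set B := \bigcup_(_ in _ | _) _; have -> : B = ~: K.
  apply/setP => v; rewrite !inE -st; apply/bigcupP/idP.
    case=> Q /andP[QG]; rewrite subsetC sub1set inE => sQ vQ.
    apply: contraL QG => /eqP/setP vs; rewrite inE negb_or.
    have h U : U \in tight_shores -> (v \in U) = (s \in U).
      by move=> Uin; have := vs U; rewrite !inE in Uin *; rewrite Uin.
    apply/andP; split; apply/negP => /h; rewrite ?inE vQ (negbTE sQ) //.
  move=> vs; have [Q /and3P[QG Qs vQ]|nQ] := pickP (fun Q : {set V} =>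
      [&& Q \in tight_sides, Q \subset ~: [set s] & v \in Q]).
    by exists Q; rewrite ?QG.
  case/eqP: vs; apply/setP => U; rewrite !(in_set (fun U => (U \in tight_shores) && _)).
  have [Uin|//] := boolP (U \in tight_shores); rewrite /=.
  have := nQ U; have := nQ (~: U).
  rewrite ![_ \in tight_sides]inE setCK Uin orbT !(subsetC _ [set s]).
  rewrite !sub1set !inE.
  by case: (v \in U); case: (s \in U).
by rewrite netC rpredN.
Qed.

End TightCuts.

(** Round [x] within the polyhedron of nonnegative vectors giving every dicut weight at least 1,
    keeping tight dicuts tight. That each arc lies in a tight dicut is used twice: a direction
    summing to 0 there and not vanishing takes both signs, and an integral solution has entries at
    most 1. *)
Lemma exists_tight_dijoin x (w : A -> R) :
  (forall a, 0 <= x a) ->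
  (forall U, dicut_shore U -> 1 <= net x U) ->
  (forall a, exists U, [/\ dicut_shore U, net x U = 1 & a \in arcs_out U]) ->
  exists J : {set A}, [/\ forall U, dicut_shore U -> J :&: arcs_out U != set0,
    forall U, dicut_shore U -> net x U = 1 -> #|J :&: arcs_out U| = 1%N &
    \sum_a w a * x a <= \sum_(a in J) w a].
Proof.
move=> x_ge0 xcover xtight.
pose I := (A + {U : {set V} | dicut_shore U})%type.
pose c (i : I) (a : A) : R := match i with
  | inl b => (a == b)%:R
  | inr U => (arc_tail a \in val U)%:R - (arc_head a \in val U)%:R end.
pose b (i : I) : R := match i with inl _ => 0 | inr _ => 1 end.
have cA f a : \sum_b c (inl a) b * f b = f a by rewrite sumr_delta.
have cU f (S : {U : {set V} | dicut_shore U}) :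
    \sum_b c (inr S) b * f b = net f (val S).
  by rewrite netE; apply: eq_bigr => a' _; rewrite mulrC.
have net_out U f : dicut_shore U -> net f U = \sum_(a in arcs_out U) f a.
  by case/and3P=> _ _ /eqP; apply: net_arcs_out.
have [||y [yfeas ytight yint wy]] := @exists_integral_point R A I c b w x.
- move=> y yfeas ytight ynint.
  have ycover U : dicut_shore U -> 1 <= net y U.
    by move=> sU; have := yfeas (inr (Sub U sU)); rewrite cU SubK subr_ge0.
  have [t|d [[a da] dint dnet]] := @exists_fractional_circulation R D _
      (fun v => [set U in tight_shores y | v \in U]) y _ ynint.
    exact: net_tight_class_int.
  (* A tight shore is a union of classes, on each of which [d] has net 0. *)
  have dtight U : dicut_shore U -> net y U = 1 -> net d U = 0.
    move=> sU yU; have Uin : U \in tight_shores y by rewrite inE sU yU eqxx.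
    rewrite /net (partition_big
      (fun v => [set U in tight_shores y | v \in U]) predT) //=.
    apply: big1 => t _; have [tU|tU] := boolP (U \in t).
      rewrite -[RHS](dnet t) /net; apply: eq_bigl => v; rewrite inE andb_idl //.
      by move=> /eqP vt; move: tU; rewrite -vt inE => /andP[].
    apply: big_pred0 => v; apply: contraNF tU => /andP[vU /eqP <-].
    by rewrite inE Uin.
  exists d; split.
  + case=> [a'|[U sU]].
      by rewrite !cA subr0 => ya; rewrite dint // ya int_num0.
    by rewrite !cU /= => /eqP; rewrite subr_eq0 => /eqP /(dtight _ sU).
  + have [U [sU xU aU]] := xtight a.
    have := ytight (inr (Sub U sU)); rewrite !cU !SubK xU subrr => /(_ erefl)/eqP.
    rewrite subr_eq0 => /eqP /(dtight _ sU); rewrite net_out // => dU.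
    by have [[a' a'0] _] := sumr_eq0_signs dU aU da; exists (inl a'); rewrite cA.
  + have [U [sU xU aU]] := xtight a.
    have := ytight (inr (Sub U sU)); rewrite !cU !SubK xU subrr => /(_ erefl)/eqP.
    rewrite subr_eq0 => /eqP /(dtight _ sU); rewrite net_out // => dU.
    by have [_ [a' a'0]] := sumr_eq0_signs dU aU da; exists (inl a'); rewrite cA.
- case=> [a|[U sU]]; first by rewrite cA subr0.
  by rewrite cU subr_ge0 xcover.
have y_ge0 a : 0 <= y a by have := yfeas (inl a); rewrite cA subr0.
have y1 U : dicut_shore U -> net x U = 1 -> net y U = 1.
  move=> sU xU; have := ytight (inr (Sub U sU)); rewrite !cU !SubK xU subrr.
  by move=> /(_ erefl)/eqP; rewrite subr_eq0 => /eqP.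
have y01 a : y a = (y a != 0)%:R.
  have [U [sU xU aU]] := xtight a.
  have : y a <= 1.
    rewrite -(y1 U sU xU) net_out // (bigD1 a) //= lerDl sumr_ge0 // => *; exact: y_ge0.
  have := y_ge0 a; have /intrP[m ->] := yint a; rewrite ler0z lerz1.
  by case: m => // [[|[|//]]] _ _; rewrite ?eqxx // -[1%:~R]/(1 : R) oner_neq0.
pose J := [set a | y a != 0].
have card_out U : dicut_shore U -> net y U = #|J :&: arcs_out U|%:R.
  move=> sU; rewrite net_out // -sum1_card natr_sum big_mkcond [RHS]big_mkcond /=.
  apply: eq_bigr => a _; rewrite !inE; have := y01 a.
  by case: (y a != 0) => ->; case: (_ && _).
exists J; split.
- move=> U sU; have := yfeas (inr (Sub U sU)); rewrite cU SubK card_out //= subr_ge0.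
  by rewrite ler1n card_gt0.
- by move=> U sU xU; apply/eqP; rewrite -(eqr_nat R) -card_out // y1.
- apply: le_trans wy _; rewrite [X in _ <= X]big_mkcond /=.
  apply: ler_sum => a _; rewrite inE; have := y01 a.
  by case: (y a != 0) => ->; rewrite ?mulr1 ?mulr0.
Qed.

End Rounding.

(** * Digraphs whose sinks have degree [tau] *)

Section Regular.
Variables (D : digraph) (tau : nat).
Local Notation V := (vertices D).
Local Notation A := (arcs D).
Hypothesis tau_gt0 : (0 < tau)%N.
Hypothesis bipD : bipartite D.
Hypothesis deg_sink : forall v : V, is_sink v -> degree v = tau.
Hypothesis dicut_ge : forall C : {set A}, is_dicut C -> (tau <= #|C|)%N.

Lemma is_dicutP (C : {set A}) :
  reflect (exists2 U, dicut_shore U & C = arcs_out U) (is_dicut C).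
Proof.
apply: (iffP existsP) => [[U /and4P[U0 UT Uin /eqP->]]|[U /and3P[U0 UT Uin] ->]].
  by exists U => //; apply/and3P.
by exists U; apply/and4P.
Qed.

Lemma arc_head_sink (a : A) : is_sink (arc_head a).
Proof. by have /orP[/forallP/(_ a)|//] := bipD (arc_head a); rewrite eqxx. Qed.

Lemma arc_tail_neq_head (a b : A) : arc_tail b != arc_head a.
Proof. exact: (forallP (arc_head_sink a)). Qed.

Lemma dicut_shore_sink (a : A) : dicut_shore (~: [set arc_head a]).
Proof.
apply/and3P; split.
- by apply/set0Pn; exists (arc_tail a); rewrite !inE arc_tail_neq_head.
- by rewrite properT; apply/eqP => /setP/(_ (arc_head a)); rewrite !inE eqxx.
- by apply/eqP/setP => b; rewrite !inE (negbTE (arc_tail_neq_head a b)).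
Qed.

Lemma mem_arcs_out_sink (a : A) : a \in arcs_out (~: [set arc_head a]).
Proof. by rewrite !inE arc_tail_neq_head eqxx. Qed.

Lemma card_arcs_out_sink (a : A) : #|arcs_out (~: [set arc_head a])| = tau.
Proof.
rewrite -(deg_sink (arc_head_sink a)) /degree.
rewrite [X in (X + _)%N](_ : _ = 0%N) ?add0n; last first.
  by apply: eq_card0 => b; rewrite inE (negbTE (arc_tail_neq_head a b)).
by apply: eq_card => b; rewrite !inE arc_tail_neq_head negbK.
Qed.

(** The star of a sink attains the lower bound [tau]. Every arc lies in such a star, so the minimum
    dicuts cover all arcs. *)
Lemma min_dicut_sink (a : A) : is_min_dicut (arcs_out (~: [set arc_head a])).
Proof.
apply/andP; split.
  by apply/is_dicutP; exists (~: [set arc_head a]) => //; apply: dicut_shore_sink.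
by apply/forallP => C; apply/implyP; rewrite card_arcs_out_sink => /dicut_ge.
Qed.

Lemma card_min_dicut (C : {set A}) : is_min_dicut C -> #|C| = tau.
Proof.
case/andP=> Cd /forallP Cmin; apply/eqP; rewrite eqn_leq dicut_ge // andbT.
have /card_gt0P[a _] := leq_trans tau_gt0 (dicut_ge Cd).
rewrite -(card_arcs_out_sink a); apply: (implyP (Cmin _)).
by have /andP[] := min_dicut_sink a.
Qed.

(** A vertex that is not a sink is a source with a leaving arc, so it is by itself the shore of a
    dicut. *)
Lemma degree_ge (v : V) : (tau <= degree v)%N.
Proof.
have [/deg_sink->//|vs] := boolP (is_sink v).
have vsrc : is_source v by have := bipD v; rewrite (negbTE vs) orbF.
have /existsP[a /negPn/eqP av] := vs.
have sv : dicut_shore [set v].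
  apply/and3P; split; first by apply/set0Pn; exists v; rewrite inE.
    rewrite properT; apply/eqP => /setP/(_ (arc_head a)); rewrite !inE.
    by rewrite (negbTE (forallP vsrc a)).
  by apply/eqP/setP => b; rewrite !inE (negbTE (forallP vsrc b)) andbF.
have : is_dicut (arcs_out [set v]) by apply/is_dicutP; exists [set v].
move=> /dicut_ge/leq_trans; apply.
apply: leq_trans (leq_addr _ _); apply: subset_leq_card.
by apply/subsetP => b; rewrite !inE => /andP[].
Qed.

Lemma card_vertices_le : (tau * #|V| <= 2 * #|A|)%N.
Proof.
have -> : (2 * #|A| = \sum_(v : V) degree v)%N.
  have card_fib (f : A -> V) : (\sum_v #|[set a | f a == v]| = #|A|)%N.
    rewrite -sum1_card (partition_big f predT) //=; apply: eq_bigr => v _.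
    by rewrite sum1dep_card.
  by rewrite /degree big_split /= !card_fib mul2n addnn.
by rewrite mulnC -sum_nat_const leq_sum // => v _; apply: degree_ge.
Qed.

(** Quantifying over all objectives [w] is the dual form of saying that [(1 + z) / tau] is a convex
    combination of such dijoins. *)
Lemma exists_tight_minimal_dijoin (R : archiRealFieldType) (z w : A -> R) :
  (forall a, `|z a| <= 1) -> (forall v, balance z v = 0) ->
  exists2 J, J \in tight_minimal_dijoins D &
    \sum_a w a * ((1 + z a) / tau%:R) <= \sum_(a in J) w a.
Proof.
move=> z1 zbal; have tau0 : 0 < tau%:R :> R by rewrite ltr0n.
pose x a := (1 + z a) / tau%:R.
(* A circulation has net 0 on every shore, so [z] does not affect the weights of dicuts. *)
have netx U : dicut_shore U -> net x U = #|arcs_out U|%:R / tau%:R.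
  move=> sU; have /and3P[_ _ /eqP Uin] := sU.
  have -> : net x U = (net (fun=> 1) U + net z U) / tau%:R.
    rewrite !netE -big_split mulr_suml /=; apply: eq_bigr => a _.
    by rewrite /x; field; rewrite gt_eqF.
  rewrite [net z U]big1 // addr0 net_arcs_out //.
  by rewrite sumr_const.
have [||| J [Jcov Jtight wJ]] := @exists_tight_dijoin R D x w.
- move=> a; rewrite divr_ge0 ?ler0n //; have := z1 a; rewrite ler_norml => /andP[]; lra.
- move=> U sU; rewrite netx // ler_pdivlMr // mul1r ler_nat dicut_ge //.
  by apply/is_dicutP; exists U.
- move=> a; exists (~: [set arc_head a]); split.
  + exact: dicut_shore_sink.
  + by rewrite netx ?dicut_shore_sink // card_arcs_out_sink divff // gt_eqF.
  + exact: mem_arcs_out_sink.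
have Jonce C : is_min_dicut C -> #|J :&: C| = 1%N.
  move=> Cmin; have /andP[/is_dicutP[U sU CU] _] := Cmin.
  rewrite CU; apply: Jtight => //; rewrite netx // -CU card_min_dicut //.
  by rewrite divff // gt_eqF.
exists J => //; rewrite inE; apply/andP; split; first last.
  by apply/forallP => C; apply/implyP => /Jonce->.
apply/andP; split.
  by apply/forallP => C; apply/implyP => /is_dicutP[U /Jcov + ->].
apply/forallP => J'; apply/implyP => /properP[sJ [a aJ aJ']].
(* Minimality: [J] meets the star of the head of [a] only in [a], so [J'] misses that star. *)
rewrite negb_forall; apply/existsP; exists (arcs_out (~: [set arc_head a])).
have Cmin := min_dicut_sink a; have /andP[-> _] := Cmin; rewrite /= negbK.
have /eqP/cards1P[b Jb] := Jonce _ Cmin.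
have := mem_arcs_out_sink a; have /setP/(_ a) := Jb;
  rewrite in_setI aJ => /= -> /set1P ab.
rewrite -subset0; apply/subsetP => c /setIP[cJ' cC].
have : c \in J :&: arcs_out (~: [set arc_head a]) by rewrite in_setI (subsetP sJ).
by rewrite Jb inE -ab => /eqP ca; rewrite ca (negbTE aJ') in cJ'.
Qed.

End Regular.

(* Maurey's empirical method, derandomised: the next set is chosen so that it does
   not correlate positively with the current error. *)
Lemma exists_average_close (R : realFieldType) (A : finType)
    (F : {set {set A}}) (x : A -> R) (q : nat) :
  (forall a, 0 <= x a <= 1) ->
  (forall w : A -> R, exists2 J, J \in F & \sum_a w a * x a <= \sum_(a in J) w a) ->
  exists2 f : {ffun 'I_q -> {set A}}, f \in ffun_on F &
    \sum_a (\sum_i (a \in f i)%:R - q%:R * x a) ^+ 2 <= q%:R * #|A|%:R.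
Proof.
move=> x01 Fx.
suff [g gF gx] : exists2 g : nat -> {set A}, forall i, g i \in F &
    \sum_a (\sum_(i < q) (a \in g i)%:R - q%:R * x a) ^+ 2 <= q%:R * #|A|%:R.
  exists [ffun i : 'I_q => g i]; first by apply/ffun_onP => i; rewrite ffunE gF.
  by under eq_bigr do under eq_bigr do rewrite ffunE.
elim: q => [|q [g gF gx]].
  have [J JF _] := Fx (fun=> 0); exists (fun=> J) => //.
  by rewrite big1 ?mul0r // => a _; rewrite big_ord0 mul0r subrr expr0n.
pose err a := \sum_(i < q) (a \in g i)%:R - q%:R * x a.
have [J JF wJ] := Fx (fun a => - err a).
exists (fun i => if i == q then J else g i); first by move=> i; case: ifP.
have corr : \sum_a err a * ((a \in J)%:R - x a) <= 0.
  have -> : \sum_a err a * ((a \in J)%:R - x a) =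
      \sum_a - err a * x a - \sum_(a in J) - err a.
    rewrite [\sum_(a in J) _]big_mkcond -sumrB; apply: eq_bigr => a _ /=.
    by case: (a \in J) => /=; ring.
  by rewrite subr_le0.
(* Expand the new squared error: the cross terms sum to at most 0 by [corr], and the square of an
   entry of the increment is at most 1, so each step adds at most [#|A|]. *)
apply: (@le_trans _ _ (\sum_a (err a ^+ 2 + 2 * (err a * ((a \in J)%:R - x a)) + 1))).
  apply: ler_sum => a _; rewrite big_ord_recr /= eqxx.
  have -> : \sum_(i < q) (a \in if i == q :> nat then J else g i)%:R =
      \sum_(i < q) (a \in g i)%:R :> R.
    by apply: eq_bigr => i _; rewrite ltn_eqF.
  have -> : \sum_(i < q) (a \in g i)%:R + (a \in J)%:R - q.+1%:R * x a =
      err a + ((a \in J)%:R - x a) by rewrite /err -natr1; ring.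
  rewrite sqrrD -mulr_natl lerD2l.
  rewrite -subr_ge0 -(expr1n _ 2) subr_sqr.
  by apply: mulr_ge0; have /andP[] := x01 a; case: (a \in J) => /=; lra.
rewrite !big_split /= -mulr_sumr sumr_const -natr1 mulrDl mul1r.
rewrite -[#|A|%:R]mulr_natl mulr1.
have -> : \sum_a err a ^+ 2 =
    \sum_a (\sum_(i < q) (a \in g i)%:R - q%:R * x a) ^+ 2 by [].
move: gx corr; lra.
Qed.

(** * Counting by symmetric differences *)

Section SymmetricDifference.
Variable A : finType.
Implicit Types E : {set A}.

Definition symdiff E E' : {set A} := [set a | (a \in E) (+) (a \in E')].

Lemma symdiff_inj E : injective (symdiff E).
Proof.
move=> E1 E2 /setP h; apply/setP => a; have := h a; rewrite !inE.
exact: addbI.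
Qed.

(** Translating a fiber of [f] by one of its members is injective and lands in [B], so every fiber
    has at most [#|B|] elements. *)
Lemma card_le_symdiff_fibers (T : finType) (X B : {set {set A}}) (Y : {set T})
    (f : {set A} -> T) :
  (forall E, E \in X -> f E \in Y) ->
  (forall E E', E \in X -> E' \in X -> f E = f E' -> symdiff E E' \in B) ->
  (#|X| <= #|Y| * #|B|)%N.
Proof.
move=> fY fB; rewrite -sum1_card (partition_big f (mem Y)) //=.
rewrite -sum_nat_const; apply: leq_sum => y _; rewrite sum1dep_card.
have [->|/set0Pn[E]] := eqVneq [set E in X | f E == y] set0; first by rewrite cards0.
rewrite inE => /andP[EX /eqP Ey].
rewrite -(card_imset _ (@symdiff_inj E)); apply: subset_leq_card.
apply/subsetP => _ /imsetP[E' + ->]; rewrite inE => /andP[E'X /eqP E'y].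
by apply: fB => //; rewrite Ey.
Qed.

End SymmetricDifference.

(* Weight every set [B] by [(1/16) ^ #|B|]; the total weight is [(1 + 1/16) ^ #|A|]. *)
Lemma card_small_sets_le (R : realType) (A : finType) :
  #|[set B : {set A} | (64 * #|B| <= #|A|)%N]|%:R <=
    expR ((1 + ln 2) / 16 * #|A|%:R) :> R.
Proof.
have e16 : expR (- (4 * ln 2)) = 1 / 16 :> R.
  by rewrite expRN expRM_natl lnK ?posrE // -natrX div1r.
have total : \sum_(B : {set A}) (1 / 16) ^+ #|B| = (1 / 16 + 1) ^+ #|A| :> R.
  rewrite -[RHS]prodr_const bigA_distr /=; apply: eq_big => // B _.
  by rewrite -big_mkcond prodr_const.
(* The term [1 / 16] bounds the total weight via [1 + 1 / 16 <= expR (1 / 16)]. The term [ln 2 / 16]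
   compensates for the weight of a small set, which is at least [16 ^ (- #|A| / 64)]. *)
rewrite mulrDl mulrDl expRD.
apply: (@le_trans _ _ ((1 / 16 + 1) ^+ #|A| * expR (ln 2 / 16 * #|A|%:R))); last first.
  rewrite ler_wpM2r ?expR_ge0 // expRM_natr.
  by rewrite lerXn2r ?nnegrE ?expR_ge0 ?addr_ge0 ?divr_ge0 // addrC expR_ge1Dx.
rewrite -total mulr_suml -sum1_card natr_sum big_mkcond /=.
apply: ler_sum => B _; rewrite inE; case: ifP => [Bs|_]; last first.
  by rewrite mulr_ge0 ?expR_ge0 // exprn_ge0 // divr_ge0.
rewrite -e16 -expRM_natl -expRD -[X in X <= _]expR0 ler_expR.
have : (64 * #|B|)%:R <= #|A|%:R :> R by rewrite ler_nat.
rewrite natrM -subr_ge0 => /(mulr_ge0 (ln_ge0 (ler1n R 2))); lra.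
Qed.

Lemma ln2_ge (R : realType) : 1 / 2 <= ln 2 :> R.
Proof.
have := expR_ge1Dx (- ln 2 : R); rewrite expRN lnK ?posrE //; lra.
Qed.

Section EvenCount.
Variable D : digraph.
Local Notation V := (vertices D).
Local Notation A := (arcs D).

Definition even_sets : {set {set A}} :=
  [set E | [forall v, ~~ odd (degree_in E v)]].

Lemma odd_degree_in_symdiff (E E' : {set A}) v :
  odd (degree_in (symdiff E E') v) = odd (degree_in E v) (+) odd (degree_in E' v).
Proof.
rewrite /degree_in !(big_morph odd oddD erefl) ![\big[addb/false]_(a in _) _]big_mkcond.
rewrite -big_split /=; apply: eq_bigr => a _; rewrite !inE.
by case: (a \in E); case: (a \in E'); case: odd.
Qed.

(** Map an arc set to the parities of its degrees: two sets with the same image have an even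
    symmetric difference. *)
Lemma card_even_sets : (2 ^ #|A| <= 2 ^ #|V| * #|even_sets|)%N.
Proof.
have := @card_le_symdiff_fibers A {ffun V -> bool} setT even_sets setT
  (fun E => [ffun v => odd (degree_in E v)]).
have -> : #|[set: {set A}]| = (2 ^ #|A|)%N by rewrite -powersetT card_powerset cardsT.
rewrite cardsT card_ffun card_bool; apply=> // E E' _ _ /ffunP h; rewrite inE.
by apply/forallP => v; have := h v;
  rewrite !ffunE odd_degree_in_symdiff => ->; rewrite addbb.
Qed.

End EvenCount.

(** Encode an even set by [q] dijoins whose average approximates [(1 + z) / tau]. Two even sets with
    the same code have signed circulations at squared distance at most [4 * tau ^ 2 * #|A| / q]; the
    value of [q] makes this [#|A| / 64]. *)
Lemma card_even_sets_le (D : digraph) (tau : nat) :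
  (1 < tau)%N -> bipartite D ->
  (forall v : vertices D, is_sink v -> degree v = tau) ->
  (forall C : {set arcs D}, is_dicut C -> (tau <= #|C|)%N) ->
  (#|even_sets D| <= #|tight_minimal_dijoins D| ^ (256 * tau ^ 2) *
    #|[set B : {set arcs D} | (64 * #|B| <= #|arcs D|)%N]|)%N.
Proof.
move=> tau1 bip deg cut; have tau0 := ltnW tau1.
set q := (256 * tau ^ 2)%N; pose A := arcs D.
have t0 : 0 < tau%:R :> rat by rewrite ltr0n.
have q0 : 0 < q%:R :> rat by rewrite ltr0n muln_gt0 expn_gt0 tau0.
have approx (E : {set A}) : exists f : {ffun 'I_q -> {set A}},
    E \in even_sets D -> f \in ffun_on (tight_minimal_dijoins D) /\
    exists z : A -> rat, [/\ forall a, a \notin E -> z a = 0,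
      forall a, a \in E -> z a = 1 \/ z a = -1 &
      \sum_a (\sum_i (a \in f i)%:R - q%:R * ((1 + z a) / tau%:R)) ^+ 2
        <= q%:R * #|A|%:R].
  (* The constant tuple is a dummy value outside the even sets, which lets [F] be chosen on all arc
     sets. *)
  have [|_] := boolP (E \in even_sets D); last by exists [ffun=> set0].
  rewrite inE => /forallP/(exists_signed_circulation rat)[z [z0 z1 zbal]].
  have zle a : `|z a| <= 1.
    have [/z1[]->|/z0->] := boolP (a \in E); by rewrite ?normrN ?normr1 ?normr0.
  have [|w|f fF fx] := @exists_average_close rat A (tight_minimal_dijoins D)
      (fun a => (1 + z a) / tau%:R) q.
  - move=> a; have := zle a; rewrite ler_norml => /andP[zl zr].
    have t2 : 2 <= tau%:R :> rat by rewrite (ler_nat _ 2).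
    by apply/andP; split; rewrite ?ler_pdivrMr // ?divr_ge0 ?ler0n //; lra.
  - exact: exists_tight_minimal_dijoin.
  by exists f => _; split=> //; exists z.
have [F HF] := fin_all_exists approx.
have -> : (#|tight_minimal_dijoins D| ^ q)%N =
    #|[set f : {ffun 'I_q -> {set A}} | f \in ffun_on (tight_minimal_dijoins D)]|.
  rewrite -[q in LHS]card_ord -card_ffun_on.
  by rewrite cardsE.
apply: (@card_le_symdiff_fibers A _ _ _ _ F) =>
  [E /HF[FE _]|E E' /HF[_ [z [z0 z1 zF]]]].
  by rewrite inE.
move=> /HF[_ [z' [z'0 z'1 z'F]]] FEE'; rewrite inE -(ler_nat rat) natrM.
rewrite -FEE' in z'F.
(* On the symmetric difference one of [z], [z'] is 0 and the other is 1 or -1. *)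
have dist : #|symdiff E E'|%:R <= \sum_a (z a - z' a) ^+ 2.
  rewrite -sum1_card natr_sum big_mkcond /=; apply: ler_sum => a _; rewrite inE.
  have [aE|aE] := boolP (a \in E); have [aE'|aE'] := boolP (a \in E') => /=;
    rewrite ?sqr_ge0 //.
    by rewrite (z'0 _ aE') subr0; case: (z1 _ aE) => ->.
  by rewrite (z0 _ aE) sub0r sqrrN; case: (z'1 _ aE') => ->.
have : \sum_a (q%:R * (z a - z' a) / tau%:R) ^+ 2 <=
    2 * (q%:R * #|A|%:R + q%:R * #|A|%:R).
  apply: le_trans (ler_wpM2l _ (lerD zF z'F)); last by [].
  rewrite -big_split mulr_sumr; apply: ler_sum => a _ /=.
  set s := \sum_i _; set u := s - _; set u' := s - _.
  have -> : q%:R * (z a - z' a) / tau%:R = u' - u.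
    by rewrite /u /u'; field; rewrite gt_eqF.
  rewrite -subr_ge0; suff -> : 2 * (u ^+ 2 + u' ^+ 2) - (u' - u) ^+ 2 = (u + u') ^+ 2.
    exact: sqr_ge0.
  by ring.
have -> : \sum_a (q%:R * (z a - z' a) / tau%:R) ^+ 2 =
    256 * (q%:R * \sum_a (z a - z' a) ^+ 2).
  rewrite !mulr_sumr; apply: eq_bigr => a _.
  by rewrite /q natrM natrX; field; rewrite gt_eqF.
have -> : 2 * (q%:R * #|A|%:R + q%:R * #|A|%:R) = q%:R * (4 * #|A|%:R) :> rat by ring.
rewrite mulrCA (ler_pM2l q0) => h.
rewrite -/A; lra.
Qed.

Theorem theorem1p9 (R : realType) (tau : nat) (tau_ge3 : (3 <= tau)%N) :
  exists theta : R, 0 < theta /\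
    forall D : digraph,
      bipartite D ->
      (forall v : vertices D, is_sink v -> degree v = tau) ->
      (forall C : {set arcs D}, is_dicut C -> (tau <= #|C|)%N) ->
      expR (theta * #|arcs D|%:R) <= #|tight_minimal_dijoins D|%:R.
Proof.
have ln2 := ln2_ge R; pose q := (256 * tau ^ 2)%N.
have q_gt0 : (0 < q)%N by rewrite muln_gt0 expn_gt0 (ltn_trans _ tau_ge3).
have q0 : 0 < q%:R :> R by rewrite ltr0n.
(* The count gives [q * ln N >= (ln 2 / 3 - (1 + ln 2) / 16) * m]. As [ln 2 >= 1 / 2], the factor is
   at least [7 / 48 * ln 2], which exceeds [ln 2 / 7]. *)
exists (ln 2 / (7 * q%:R)); split; first by apply: divr_gt0; lra.
move=> D bip deg cut; set m := #|arcs D|; set N := #|tight_minimal_dijoins D|.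
have tau_gt1 : (1 < tau)%N by exact: ltnW.
have Vm : (3 * #|vertices D| <= 2 * m)%N.
  apply: leq_trans (card_vertices_le bip deg cut).
  by rewrite leq_mul2r tau_ge3 orbT.
have := leq_trans (card_even_sets D)
  (leq_mul (leqnn _) (card_even_sets_le tau_gt1 bip deg cut)).
set S := #|[set B : {set arcs D} | _]|; rewrite -/q -/m -/N => count.
have {count} : 2 ^+ m <= 2 ^+ #|vertices D| * (N%:R ^+ q * S%:R) :> R.
  by rewrite -!natrX -!natrM ler_nat.
have Sle : S%:R <= expR ((1 + ln 2) / 16 * m%:R) :> R.
  exact: card_small_sets_le.
have exp2 n : 2 ^+ n = expR (n%:R * ln 2) :> R by rewrite expRM_natl lnK ?posrE.
(* The logarithm needs [N > 0]; for [N = 0] the right side of the count would vanish, because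
   [q > 0]. *)
have [->|N0] := posnP N.
  rewrite expr0n (gtn_eqF q_gt0) mul0r mulr0 exp2 => h.
  by have := expR_gt0 (m%:R * ln 2 : R); rewrite ltNge h.
have Npos : 0 < N%:R :> R by rewrite ltr0n.
rewrite -[N%:R]lnK ?posrE // -expRM_natl !exp2 => h.
have : expR (m%:R * ln 2) <= expR (#|vertices D|%:R * ln 2 +
    (q%:R * ln N%:R + (1 + ln 2) / 16 * m%:R)) :> R.
  rewrite !expRD; apply: le_trans h _.
  by rewrite ler_wpM2l ?expR_ge0 // ler_wpM2l ?expR_ge0.
rewrite !ler_expR => {}h.
rewrite mulrAC ler_pdivrMr; last by lra.
have {}Vm : 3 * #|vertices D|%:R <= 2 * m%:R :> R by rewrite -!natrM ler_nat.
have m0 : 0 <= m%:R :> R by rewrite ler0n.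
have h1 : #|vertices D|%:R * ln 2 <= 2 / 3 * m%:R * ln 2 :> R.
  by apply: ler_wpM2r; lra.
have h2 : m%:R / 2 <= m%:R * ln 2 :> R by apply: ler_wpM2l; lra.
lra.
Qed.
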